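(* Let $S$ be a finite poset. Then \[ \begin{pmatrix}\phi^0_S(x)\\ \phi^1_S(x)\end{pmatrix}=\frac{1}{x}\begin{pmatrix}x+1&-1\\-(x^2+x+1)&x+1\end{pmatrix}\begin{pmatrix}\phi_S(x)\\ \phi_{\widehat{S}}(x)\end{pmatrix}, \] where $\widehat{S}$ is the poset obtained from $S$ by adjoining a unique maximal element.
   Context: For a finite poset $S$, let $C_S$ be the $S\times S$ matrix with $(C_S)_{st}=1$ if $t\le s$ and $0$ otherwise (the Cartan matrix of the incidence algebra $KS$ over any field $K$). The Coxeter polynomial of $S$ is $\phi_S(x)=\det(xC_S+C_S^T)$, with $\phi_\varnothing=1$. The poset $\widehat{S}=S\cup\{\widehat{1}\}$ has $s<\widehat{1}$ for all $s\in S$. Refined Coxeter polynomials $\phi^0_S,\phi^1_S\in\mathbb{Z}[x]$: if $S=\varnothing$, $\phi^0_S=0$ and $\phi^1_S=1$. If $S\neq\varnothing$, choose $s\in S$, put $S'=S\setminus\{s\}$, and let $A$ be the matrix obtained from $xC_S+C_S^T$ by subtracting the $s$-th row from all other rows and then subtracting the $s$-th column from all other columns; then \[ \phi^0_S(x)=\sum_{\sigma\in\Sigma_{S'}}\mathrm{sgn}(\sigma)\prod_{i\in S'}A_{i\sigma(i)},\qquad \phi^1_S(x)=\sum_{\sigma\in\Sigma_S,\ \sigma(s)\ne s}\mathrm{sgn}(\sigma)\prod_{i\in S}A_{i\sigma(i)}, \] where $\Sigma_{S'},\Sigma_S$ are the permutation groups of $S'$ and $S$; these do not depend on the choice of $s$.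 *)

(* Defs.v *)
From HB Require Import structures.
From mathcomp Require Import all_boot all_order all_algebra all_fingroup.
Set Implicit Arguments.
Unset Strict Implicit.
Unset Printing Implicit Defensive.
Import Order.TTheory GRing.Theory.
Local Open Scope ring_scope.

(* S together with a new greatest element None. *)
Definition adjoin_top (d : Order.disp_t) (S : finPOrderType d) : Type :=
  option S.

Section AdjoinTop.
Variables (d : Order.disp_t) (S : finPOrderType d).

HB.instance Definition _ := Finite.copy (adjoin_top S) (option S).

Definition adjoin_top_le (u v : adjoin_top S) : bool :=
  match u, v with
  | _, None => true
  | None, Some _ => false
  | Some s, Some t => (s <= t)%O
  end.

Fact adjoin_top_le_refl : reflexive adjoin_top_le.
Proof. by case=> /=. Qed.

Fact adjoin_top_le_anti : antisymmetric adjoin_top_le.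
Proof. by case=> [s|] [t|] //= /le_anti ->. Qed.

Fact adjoin_top_le_trans : transitive adjoin_top_le.
Proof. by case=> [s|] [t|] [u|] //=; apply: le_trans. Qed.

HB.instance Definition _ := Order.Le_isPOrder.Build d (adjoin_top S)
  adjoin_top_le_refl adjoin_top_le_anti adjoin_top_le_trans.

Fact adjoin_top_lex1 (u : adjoin_top S) : (u <= (None : adjoin_top S))%O.
Proof. by case: u. Qed.

HB.instance Definition _ :=
  Order.hasTop.Build d (adjoin_top S) adjoin_top_lex1.

End AdjoinTop.

(* S x S matrices are indexed by 'I_#|S| through enum_val and enum_rank. *)
Definition cartan_mx (d : Order.disp_t) (S : finPOrderType d) : 'M[int]_#|S| :=
  \matrix_(i, j) ((enum_val j <= enum_val i)%O : bool)%:R.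

Definition coxeter_mx (d : Order.disp_t) (S : finPOrderType d) :
    'M[{poly int}]_#|S| :=
  'X *: map_mx polyC (cartan_mx S) + (map_mx polyC (cartan_mx S))^T.

Definition coxeter_poly (d : Order.disp_t) (S : finPOrderType d) : {poly int} :=
  \det (coxeter_mx S).

Section Reduction.
Variables (R : comNzRingType) (n : nat).
Implicit Types (M : 'M[R]_n) (k : 'I_n).

Definition sub_row k M : 'M[R]_n :=
  \matrix_(i, j) (if i == k then M i j else M i j - M k j).

Definition sub_col k M : 'M[R]_n :=
  \matrix_(i, j) (if j == k then M i j else M i j - M i k).

(* Sym [set~ k] is the group of permutations of the indices other than k. *)
Definition reduced0 k M : R :=
  let A := sub_col k (sub_row k M) in
  \sum_(sigma in Sym [set~ k])
    (-1) ^+ sigma * \prod_(i in [set~ k]) A i (sigma i).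

Definition reduced1 k M : R :=
  let A := sub_col k (sub_row k M) in
  \sum_(sigma : 'S_n | sigma k != k)
    (-1) ^+ sigma * \prod_i A i (sigma i).

Lemma reduced0_cofactor k M :
  reduced0 k M = cofactor (sub_col k (sub_row k M)) k k.
Proof.
rewrite /reduced0 expand_cofactor; apply: eq_big => [s | s _].
  rewrite inE; apply/idP/idP => [/out_perm -> // | /eqP sk].
    by rewrite !inE eqxx.
  apply/subsetP=> i; rewrite !inE; apply: contra => /eqP->.
  by rewrite sk.
congr (_ * _); apply: eq_bigl => i.
by rewrite !inE eq_sym.
Qed.

Lemma det_reduced k M :
  \det (sub_col k (sub_row k M)) = M k k * reduced0 k M + reduced1 k M.
Proof.
set A := sub_col _ _.
rewrite reduced0_cofactor -/A expand_cofactor {1}/determinant.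
rewrite (bigID (fun s : 'S_n => s k == k)) /=; congr (_ + _).
rewrite big_distrr; apply: eq_bigr => s /eqP sk.
rewrite (bigD1 k) //= sk !mxE !eqxx mulrCA; congr (_ * (_ * _)).
by apply: eq_bigl => i; rewrite eq_sym.
Qed.

Lemma det_sub_row_col k M : \det (sub_col k (sub_row k M)) = \det M.
Proof.
pose P : 'M[R]_n := \matrix_(i, j)
  ((i == j)%:R - ((i != k) && (j == k))%:R).
have sumP (F : 'I_n -> R) i :
    \sum_j P i j * F j = if i == k then F i else F i - F k.
  transitivity (F i - (i != k)%:R * F k).
    under eq_bigr => j _ do rewrite mxE mulrBl.
    rewrite sumrB; congr (_ - _).
      rewrite (bigD1 i) //= eqxx mul1r big1 ?addr0 // => j.
      by rewrite eq_sym => /negPf ->; rewrite mul0r.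
    rewrite (bigD1 k) //= eqxx andbT big1 ?addr0 // => j /negPf ->.
    by rewrite andbF mul0r.
  by case: (i == k); rewrite /= ?mul0r ?subr0 ?mul1r.
have rowE (B : 'M[R]_n) : sub_row k B = P *m B.
  by apply/matrixP=> i j; rewrite !mxE (sumP (B^~ j)).
have colE (B : 'M[R]_n) : sub_col k B = B *m P^T.
  apply/matrixP=> i j; rewrite !mxE.
  under eq_bigr => l _ do rewrite [P^T _ _]mxE mulrC.
  by rewrite (sumP (B i)).
have detP : \det P = 1.
  rewrite (expand_det_row _ k) (bigD1 k) //= big1 => [|j jk]; last first.
    by rewrite mxE eq_sym (negPf jk) eqxx /= subr0 mul0r.
  rewrite addr0 mxE !eqxx subr0 mul1r /cofactor -signr_odd addnn odd_double mul1r.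
  rewrite (_ : row' k (col' k P) = 1%:M) ?det1 //.
  apply/matrixP=> i j; rewrite !mxE (inj_eq lift_inj).
  by rewrite [lift k j == k]eq_sym (negPf (neq_lift k j)) andbF subr0.
by rewrite colE rowE !det_mulmx det_tr detP mul1r mulr1.
Qed.

Lemma reduced0E k M : reduced0 k M = \det (M + const_mx 1) - \det M.
Proof.
rewrite -(det_sub_row_col k M) -(det_sub_row_col k (M + _)) !det_reduced.
have addK1 (a b : R) : (a + 1) - (b + 1) = a - b.
  by rewrite opprD addrACA subrr addr0.
have A1 i j : (i != k) || (j != k) ->
    sub_col k (sub_row k (M + const_mx 1)) i j = sub_col k (sub_row k M) i j.
  by rewrite !mxE; case: (i == k); case: (j == k) => //= _; rewrite !addK1.
have -> : reduced0 k (M + const_mx 1) = reduced0 k M.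
  apply: eq_bigr => s _; congr (_ * _); apply: eq_bigr => i.
  by rewrite !inE => ik; rewrite A1 ?ik.
have -> : reduced1 k (M + const_mx 1) = reduced1 k M.
  apply: eq_bigr => s sk; congr (_ * _); apply: eq_bigr => i _; apply: A1.
  by case: (eqVneq i k) => [->|].
rewrite mxE [const_mx 1 k k]mxE mulrDl mul1r.
by rewrite [_ + reduced0 k M]addrC -[_ + reduced1 k M]addrA addrK.
Qed.

Lemma reduced1E k M : reduced1 k M = \det M - M k k * reduced0 k M.
Proof. by rewrite -(det_sub_row_col k M) det_reduced addrAC subrr add0r. Qed.

End Reduction.

Definition refined_coxeter0 (d : Order.disp_t) (S : finPOrderType d) :
    {poly int} :=
  if [pick s : S] is Some s then reduced0 (enum_rank s) (coxeter_mx S) else 0.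

Definition refined_coxeter1 (d : Order.disp_t) (S : finPOrderType d) :
    {poly int} :=
  if [pick s : S] is Some s then reduced1 (enum_rank s) (coxeter_mx S) else 1.

(* The refined Coxeter polynomials can be computed from any element of S. *)
Lemma refined_coxeter0E (d : Order.disp_t) (S : finPOrderType d) (s : S) :
  refined_coxeter0 S = reduced0 (enum_rank s) (coxeter_mx S).
Proof.
rewrite /refined_coxeter0; case: pickP => [t _ | /(_ s) //].
by rewrite !reduced0E.
Qed.

Lemma refined_coxeter1E (d : Order.disp_t) (S : finPOrderType d) (s : S) :
  refined_coxeter1 S = reduced1 (enum_rank s) (coxeter_mx S).
Proof.
rewrite /refined_coxeter1; case: pickP => [t _ | /(_ s) //].
by rewrite !reduced1E !reduced0E !mxE !lexx.
Qed.

Definition cV2 (R : Type) (a b : R) : 'cV[R]_2 :=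
  \col_i if i == 0 then a else b.

Definition mx22 (R : Type) (a b c e : R) : 'M[R]_2 :=
  \matrix_(i, j) if i == 0 then (if j == 0 then a else b)
                 else (if j == 0 then c else e).

(* Main.v *)
Require Import Defs.
From mathcomp Require Import all_boot all_order all_algebra.
From mathcomp Require Import perm ring.
Import Order.TTheory GRing.Theory.
Local Open Scope ring_scope.

(** Order the elements of the extended poset with the new top last.  Every
    element lies below the top, so with [M] the Coxeter matrix of [S] the Coxeter
    matrix of the extension is the bordered matrix with blocks
    [[
        M     1
        x 1   x + 1
    ]]
    Its last row is [- x] times the row [(-1, ..., -1, 1)] plus
    [(0, ..., 0, 2 x + 1)].  With the former row, adding the last column to all
    others turns the determinant into [det (M + J)], where [J] is the all-ones
    matrix; the latter row contributes [(2 x + 1) det M].  Since [phi^0 = det (M + J) - det M]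
    ([refined_coxeter0_det]), this is
    [phi_top = (x + 1) phi - x phi^0] ([coxeter_poly_adjoin_top]), the first row of
    the matrix identity.  All diagonal entries of [M] are [x + 1], so splitting
    the determinant of the reduced matrix, which equals [det M], according to
    whether a permutation fixes the chosen element gives
    [phi = (x + 1) phi^0 + phi^1] ([refined_coxeter1_det]); eliminating [phi^0]
    between the two gives the second row. *)

(** The indexing of the Coxeter matrix of the extended poset by an enumeration
    is unrelated to that of [S], so comparing them takes a relabelling. *)
Lemma det_mxsub_inj {R : comPzRingType} {m n} (f : 'I_m -> 'I_n)
    (A : 'M[R]_n) : m = n -> injective f -> \det (mxsub f f A) = \det A.
Proof.
move=> mn; subst n => f_inj.
have -> : mxsub f f A = row_perm (perm f_inj) (col_perm (perm f_inj) A).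
  by apply/matrixP => i j; rewrite !mxE !permE.
rewrite row_permE col_permE !det_mulmx !det_perm odd_permV.
by rewrite mulrCA -signr_addb addbb mulr1.
Qed.

(** The last row is split as [- a] times [(-1, ..., -1, 1)] plus
    [(0, ..., 0, 2 a + 1)], so that each part has a block-triangular reduction and
    no adjugate of [M] enters. *)
Lemma det_border_ones {R : comNzRingType} {n} (M : 'M[R]_n) (a : R) :
  \det (block_mx M (const_mx 1) (const_mx a) (const_mx (a + 1)) : 'M_(n + 1))
  = (a + 1) * \det M - a * (\det (M + const_mx 1) - \det M).
Proof.
pose B : 'M_(n + 1) := block_mx M (const_mx 1) (const_mx (- 1)) 1%:M.
pose C : 'M_(n + 1) := block_mx M (const_mx 1) 0 1%:M.
rewrite (@determinant_multilinear _ _ _ B C (rshift n ord0) (- a) (2 * a + 1)).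
- have detC : \det C = \det M by rewrite det_ublock det1 mulr1.
  (* Adding the last column to all others clears the last row up to the corner. *)
  have detB : \det B = \det (M + const_mx 1).
    pose E : 'M[R]_(n + 1) := block_mx 1%:M 0 (const_mx 1) 1%:M.
    have -> : \det B = \det (B *m E).
      by rewrite det_mulmx [\det E]det_lblock !det1 !mulr1.
    rewrite /B /E mulmx_block !mulmx1 !mulmx0 !mul1mx !add0r.
    have -> : const_mx (- 1) + const_mx 1 = 0 :> 'M[R]_(1, n).
      by apply/matrixP => i j; rewrite !mxE addNr.
    rewrite det_ublock det1 mulr1; congr (\det (_ + _)).
    by apply/matrixP => i j; rewrite !mxE big_ord1 !mxE mulr1.
  rewrite detB detC; ring.
- rewrite !rowKd !row_id !scale_row_mx add_row_mx.
  by congr row_mx; apply/matrixP => i j; rewrite !mxE ?ord1 /=; ring.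
- by rewrite !row'Kd; congr (castmx _ (col_mx _ _)); apply/matrixP => [[]].
- by rewrite !row'Kd; congr (castmx _ (col_mx _ _)); apply/matrixP => [[]].
Qed.

Section Coxeter.
Variables (d : Order.disp_t) (S : finPOrderType d).

Lemma coxeter_mxE (i j : 'I_#|S|) :
  coxeter_mx S i j = 'X * (enum_val j <= enum_val i)%O%:R
                     + (enum_val i <= enum_val j)%O%:R.
Proof. by rewrite !mxE !rmorph_nat. Qed.

(** Adding [J] survives the reduction only in the diagonal entry at the chosen
    element, where it is multiplied by the minor [phi^0].  For empty [S] the two
    determinants coincide. *)
Lemma refined_coxeter0_det :
  refined_coxeter0 S
  = \det (coxeter_mx S + const_mx 1) - \det (coxeter_mx S).
Proof.
rewrite /refined_coxeter0; case: pickP => [s _ | S0]; first exact: reduced0E.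
have -> : coxeter_mx S + const_mx 1 = coxeter_mx S.
  by apply/matrixP => i; have := S0 (enum_val i).
by rewrite subrr.
Qed.

Lemma refined_coxeter1_det :
  refined_coxeter1 S = coxeter_poly S - ('X + 1) * refined_coxeter0 S.
Proof.
rewrite /refined_coxeter1 /refined_coxeter0 /coxeter_poly.
case: pickP => [s _ | S0].
  by rewrite reduced1E coxeter_mxE lexx mulr1.
have S_empty : #|S| = 0%N by apply: eq_card0.
rewrite mulr0 subr0; move: (coxeter_mx S); rewrite S_empty => M.
by rewrite det_mx00.
Qed.

End Coxeter.

Lemma coxeter_poly_adjoin_top {d : Order.disp_t} (S : finPOrderType d) :
  coxeter_poly (adjoin_top S)
  = ('X + 1) * coxeter_poly S - 'X * refined_coxeter0 S.
Proof.
pose g (i : 'I_(#|S| + 1)) : adjoin_top S :=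
  if split i is inl j then Some (enum_val j) else None.
have g_inj : injective g.
  move=> i j; rewrite /g.
  case: (split_ordP i) => i' ->; case: (split_ordP j) => j' -> //.
    by case=> /enum_val_inj ->.
  by rewrite (ord1 i') (ord1 j').
have f_inj : injective (enum_rank \o g) := inj_comp enum_rank_inj g_inj.
have cardE : (#|S| + 1)%N = #|{: adjoin_top S}| by rewrite card_option addn1.
rewrite refined_coxeter0_det -det_border_ones /coxeter_poly.
rewrite -(det_mxsub_inj _ (coxeter_mx (adjoin_top S)) cardE f_inj); congr (\det _).
apply/matrixP => i j; rewrite mxE coxeter_mxE /= !enum_rankK /g.
case: (split_ordP i) => i' ->; case: (split_ordP j) => j' ->.
- by rewrite block_mxEul coxeter_mxE.
- by rewrite block_mxEur mxE mulr0 add0r.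
- by rewrite block_mxEdl mxE mulr1 addr0.
- by rewrite block_mxEdr mxE lexx mulr1.
Qed.

(** The elimination behind the matrix identity: [p] is [phi] and [q] is [phi^0].
    An abstract [F] keeps the field laws opaque; those of the field of fractions
    unfold to quotients of pairs of polynomials and make normalization blow up. *)
Lemma refined_elimination {F : fieldType} (x p q : F) : x != 0 ->
  q = x^-1 * ((x + 1) * p + - 1 * ((x + 1) * p - x * q)) /\
  p - (x + 1) * q =
    x^-1 * (- (x ^+ 2 + x + 1) * p + (x + 1) * ((x + 1) * p - x * q)).
Proof. by move=> x_neq0; split; field. Qed.

Theorem proposition3p19 (d : Order.disp_t) (S : finPOrderType d) :
  let x : {fraction {poly int}} := tofrac 'X in
  map_mx (@tofrac _) (cV2 (refined_coxeter0 S) (refined_coxeter1 S)) =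
  x^-1 *: (mx22 (x + 1)                (- 1)
                (- (x ^+ 2 + x + 1))   (x + 1)
           *m map_mx (@tofrac _)
                (cV2 (coxeter_poly S) (coxeter_poly (adjoin_top S)))).
Proof.
move=> x; have x_neq0 : x != 0 by rewrite tofrac_eq0 polyX_eq0.
apply/colP => i; rewrite !mxE big_ord_recl big_ord1 !mxE /=.
rewrite refined_coxeter1_det coxeter_poly_adjoin_top.
move: (coxeter_poly S) (refined_coxeter0 S) => p q.
rewrite (fun_if (@tofrac _)) !(tofracB, tofracM, tofracD, tofrac1) -/x.
have [eq0 eq1] := refined_elimination _ (tofrac p) (tofrac q) x_neq0.
by case: (i == 0); [exact: eq0 | exact: eq1].
Qed.
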